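(* Let $s\ge1$. There exists a bijection $\Psi\colon\mathrm{RC}^{HW}(B^{2,s})\to\mathcal A$ such that, for all $(\nu,J)\in\mathrm{RC}^{HW}(B^{2,s})$, $$\mathrm{cc}(\nu,J)=\mathrm{gr}\bigl(\Psi(\nu,J)\bigr),\qquad\overline{\mathrm{wt}}(\nu,J)=\overline{\mathrm{wt}}\bigl(\Psi(\nu,J)\bigr).$$
   Context: **Setting.** Type $D_4^{(3)}$, classical subalgebra of type $G_2$ with $I_0=\{1,2\}$, $A_{11}=A_{22}=2$, $A_{12}=\langle h_1,\alpha_2\rangle=-3$, $A_{21}=-1$, $\overline\alpha_1=2\overline\Lambda_1-\overline\Lambda_2$, $\overline\alpha_2=-3\overline\Lambda_1+2\overline\Lambda_2$. **The index set.** $\mathcal A=\{r=(r_1,r_2,r_3,r_4)\in\mathbb Z_{\ge0}^4\mid r_3\le r_1,\ r_1+r_2+r_3+r_4\le s\}$, $\overline{\mathrm{wt}}(r)=(r_1+r_2-r_3)\overline\Lambda_1+(s-r_1-r_2-r_4)\overline\Lambda_2$, $\mathrm{gr}(r)=r_1+2r_2+2r_3+3r_4$. **Highest weight rigged configurations for $B^{2,s}$.** A configuration is a pair of partitions $\nu=(\nu^{(1)},\nu^{(2)})$; $m_i^{(a)}$ is the number of parts $i$ in $\nu^{(a)}$; vacancy numbers $p_i^{(a)}=\delta_{a,2}\min(i,s)-\sum_{b\in I_0,\,j\ge1}A_{ab}\min(i,j)m_j^{(b)}$. $\mathrm{RC}^{HW}(B^{2,s})$ is the set of pairs $(\nu,J)$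 with $J_i^{(a)}$ a multiset of $m_i^{(a)}$ integers $x$ with $0\le x\le p_i^{(a)}$, and with dominant weight $\overline{\mathrm{wt}}(\nu,J)=s\overline\Lambda_2-|\nu^{(1)}|\overline\alpha_1-|\nu^{(2)}|\overline\alpha_2$. **Cocharge.** $\mathrm{cc}(\nu,J)=\frac12\sum_{a,b\in I_0}\sum_{i,j\ge1}(\alpha_a|\alpha_b)\min(i,j)m_i^{(a)}m_j^{(b)}+\sum_{a\in I_0}t_a^\vee\sum_{i\ge1}\sum_{x\in J_i^{(a)}}x$, where $t_1^\vee=1$, $t_2^\vee=3$, $(\alpha_1|\alpha_1)=2$, $(\alpha_1|\alpha_2)=-3$, $(\alpha_2|\alpha_2)=6$. *)

(* Defs.v *)
From mathcomp Require Import all_boot all_order all_algebra.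
From mathcomp Require Import finmap multiset.
From mathcomp Require Import boolp classical_sets functions.

Set Implicit Arguments.
Unset Strict Implicit.
Unset Printing Implicit Defensive.

Import Order.TTheory GRing.Theory Num.Theory.

Local Open Scope ring_scope.
Local Open Scope mset_scope.
Local Open Scope classical_set_scope.

(* The nodes 1 and 2 of I_0 are the ordinals 0 and 1 of 'I_2. *)
Definition I0 := 'I_2.
Definition node1 : I0 := ord0.
Definition node2 : I0 := ord_max.

(* cartan a b = <h_a, alpha_b> *)
Definition cartan (a b : I0) : int :=
  if a == b then 2 else if a == node1 then -3 else -1.

(* (alpha_a | alpha_b) *)
Definition root_form (a b : I0) : int :=
  if a == b then (if a == node1 then 2 else 6) else -3.

Definition tvee (a : I0) : int := if a == node1 then 1 else 3.

(* The classical weight lattice, in the basis of fundamental weights. *)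
Definition weight := 'rV[int]_2.

Definition Lambda (a : I0) : weight := delta_mx 0 a.

Definition alpha (a : I0) : weight :=
  if a == node1 then 2 *: Lambda node1 - Lambda node2
  else - 3 *: Lambda node1 + 2 *: Lambda node2.

Definition dominant (w : weight) : Prop := forall a : I0, 0 <= w 0 a.

(* A partition is the weakly decreasing sequence of its positive parts. *)
Definition is_partition (p : seq nat) : bool := sorted geq p && (0%N \notin p).

Definition configuration := I0 -> seq nat.

Definition mult (nu : configuration) (a : I0) (i : nat) : nat :=
  count_mem i (nu a).

(* Parts of nu a are at most sumn (nu a), so every sum over i >= 1 weighted by
   mult nu a i is cut off there. *)
Definition vacancy (s : nat) (nu : configuration) (a : I0) (i : nat) : int :=
  (if a == node2 then (minn i s)%:Z else 0)
  - \sum_(b : I0) \sum_(1 <= j < (sumn (nu b)).+1)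
      cartan a b * (minn i j)%:Z * (mult nu b j)%:Z.

(* A pair (nu, J), where J a i is the multiset of riggings J_i^(a). *)
Definition rigged_configuration :=
  (configuration * (I0 -> nat -> {mset int}))%type.

Definition rc_wt (s : nat) (x : rigged_configuration) : weight :=
  Lambda node2 *+ s - \sum_(a : I0) alpha a *+ sumn (x.1 a).

(* RC^HW(B^{2,s}). The size condition also covers i = 0, where it forces the
   unused J a 0 to be empty, as 0 is not a part. *)
Definition RCHW (s : nat) : set rigged_configuration :=
  [set x : rigged_configuration |
   [/\ forall a, is_partition (x.1 a),
       forall a i, size (x.2 a i) = mult x.1 a i,
       forall a i (k : int), k \in x.2 a i -> 0 <= k <= vacancy s x.1 a i
     & dominant (rc_wt s x)]].

Definition cc (x : rigged_configuration) : rat :=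
  2^-1 * (\sum_(a : I0) \sum_(b : I0)
            \sum_(1 <= i < (sumn (x.1 a)).+1) \sum_(1 <= j < (sumn (x.1 b)).+1)
              root_form a b * (minn i j)%:Z
                * (mult x.1 a i)%:Z * (mult x.1 b j)%:Z)%:~R
  + (\sum_(a : I0) tvee a *
       \sum_(1 <= i < (sumn (x.1 a)).+1) \sum_(k <- x.2 a i) k)%:~R.

Definition quadruple := (nat * nat * nat * nat)%type.

Definition Aset (s : nat) : set quadruple :=
  [set r : quadruple | let: (r1, r2, r3, r4) := r in
           (r3 <= r1)%N /\ (r1 + r2 + r3 + r4 <= s)%N].

Definition A_wt (s : nat) (r : quadruple) : weight :=
  let: (r1, r2, r3, r4) := r in
  (r1%:Z + r2%:Z - r3%:Z) *: Lambda node1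
  + (s%:Z - r1%:Z - r2%:Z - r4%:Z) *: Lambda node2.

Definition gr (r : quadruple) : nat :=
  let: (r1, r2, r3, r4) := r in (r1 + 2 * r2 + 2 * r3 + 3 * r4)%N.

(* Main.v *)
(* Write Q_i(p) for the number of boxes in the first i columns of a partition p.
   Away from the parts of nu^(a), the vacancy number p_i^(a) is concave in i;
   being nonnegative at these parts, at 0 and, by dominance, at infinity, it is
   nonnegative for all i. At i = 1 this bounds the numbers of rows: they are
   (0,0), (1,1) or (3,2). Looking at the parts once more, one finds exactly
     nu^(1) = (a + c, c, c),  nu^(2) = (b + c, c),
     b <= a,  2a <= 3b,  b + c <= s,
   up to zero parts, where all riggings vanish except that x of the row a + c,
   which ranges over 0 <= x <= 3b - 2a. The bijection sends this rigged
   configuration to r = (2b - a - x, x, a - b, c), so that conversely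
   a = r1 + r2 + 2 r3, b = r1 + r2 + r3, c = r4 and x = r2. *)
Require Import Defs.
From mathcomp Require Import all_boot all_order all_algebra.
From mathcomp Require Import finmap multiset.
From mathcomp Require Import boolp classical_sets functions.
From mathcomp Require Import zify ring.

Import Order.TTheory GRing.Theory Num.Theory.

Local Open Scope ring_scope.

(** * Box counts in the first columns of a partition *)

(* Q_i(p) *)
Definition box (p : seq nat) (i : nat) : nat := (\sum_(j <- p) minn i j)%N.

Lemma box_nil i : box [::] i = 0%N.
Proof. by rewrite /box big_nil. Qed.

Lemma box_cons j p i : box (j :: p) i = (minn i j + box p i)%N.
Proof. by rewrite /box big_cons. Qed.

Definition boxE := (box_cons, box_nil).

Lemma box0 p : box p 0 = 0%N.
Proof. by elim: p => [|j p IHp]; rewrite !boxE // IHp min0n. Qed.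

Lemma box_size p : 0%N \notin p -> box p 1 = size p.
Proof.
elim: p => [|j p IHp]; rewrite !boxE // inE negb_or => /andP[j0 /IHp->] /=.
by lia.
Qed.

Lemma box_sumn p i : (sumn p <= i)%N -> box p i = sumn p.
Proof.
elim: p => [|j p IHp]; rewrite !boxE //= => le_i.
by rewrite IHp; lia.
Qed.

(** A row of length j contributes [minn i j], which has slope 1 up to j and slope 0 afterwards, so
    each row bends the count exactly once, at its own length. *)
Lemma box_second_difference p i :
  (box p i + box p i.+2 + count_mem i.+1 p = 2 * box p i.+1)%N.
Proof.
elim: p => [|j p IHp]; rewrite !boxE //=.
move: (count _ p) IHp => c IHp; case: eqVneq => [->|?] /=; lia.
Qed.

Lemma box_concave p i : (box p i + box p i.+2 <= 2 * box p i.+1)%N.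
Proof. by rewrite -box_second_difference leq_addr. Qed.

Lemma box_linear p i :
  i.+1 \notin p -> (box p i + box p i.+2 = 2 * box p i.+1)%N.
Proof. by move=> /count_memPn p'i; rewrite -box_second_difference p'i addn0. Qed.

Lemma box_pos p i : box [seq j <- p | (0 < j)%N] i = box p i.
Proof.
elim: p => [|[|j] p IHp] //=; first by rewrite !boxE IHp minn0.
by rewrite !boxE IHp.
Qed.

Lemma sumn_pos p : sumn [seq j <- p | (0 < j)%N] = sumn p.
Proof. by elim: p => [|[|j] p IHp] //=; rewrite IHp. Qed.

Lemma sum_pos (p : seq nat) (F : nat -> int) : F 0%N = 0 ->
  \sum_(j <- [seq j <- p | (0 < j)%N]) F j = \sum_(j <- p) F j.
Proof.
move=> F0; rewrite big_filter big_mkcond; apply: eq_bigr => -[|j] _ //=.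
Qed.

(* The first negative value would start a strictly decreasing run that never
   returns to a nonnegative value. *)
Lemma ge0_of_concave_at_neg (f : nat -> int) (N : nat) :
    0 <= f 0%N -> 0 <= f N ->
    (forall i, 0 <= f i.+1 \/ f i + f i.+2 <= 2 * f i.+1) ->
  forall i, (i <= N)%N -> 0 <= f i.
Proof.
move=> f0 fN fc i leiN; rewrite leNgt; apply/negP => fi.
have exneg : exists i, f i < 0 by exists i.
case: (ex_minnP exneg) => m fm mmin.
have leim := mmin _ fi.
case: m => [|m] in fm mmin leim; first by lia.
have fm0 : 0 <= f m by rewrite leNgt; apply/negP => /mmin; lia.
have run k : f (m + k).+1 < 0 /\ f (m + k).+1 < f (m + k)%N.
  elim: k => [|k [IH1 IH2]]; first by rewrite addn0; lia.
  by have := fc (m + k)%N; rewrite addnS; lia.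
have [] := run (N - m.+1)%N.
have -> : (m + (N - m.+1)).+1 = N by lia.
by lia.
Qed.

(** * Sums over nodes and over the parts of a partition *)

Lemma node_ind (P : I0 -> Prop) : P node1 -> P node2 -> forall a, P a.
Proof.
move=> P1 P2 [[|[|//]] lta].
  by have -> : Ordinal lta = node1 by apply: val_inj.
by have -> : Ordinal lta = node2 by apply: val_inj.
Qed.

Lemma sum_nodes (V : nmodType) (F : I0 -> V) :
  \sum_(a : I0) F a = F node1 + F node2.
Proof.
rewrite big_ord_recl big_ord1.
by have -> : lift ord0 ord0 = node2 by apply: val_inj.
Qed.

Lemma leq_sumn p i : i \in p -> (i <= sumn p)%N.
Proof.
elim: p => //= j p IHp; rewrite inE => /predU1P[->|/IHp]; lia.
Qed.

Lemma sum_delta (V : nmodType) (m n j : nat) (F : nat -> V) :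
  (m <= j < n)%N -> \sum_(m <= i < n) (if i == j then F i else 0) = F j.
Proof.
by move=> /andP[mj jn]; rewrite -big_mkcond /= big_nat1_eq mj jn.
Qed.

Lemma sum_count (p : seq nat) (F : nat -> int) : 0%N \notin p ->
  \sum_(1 <= i < (sumn p).+1) F i * (count_mem i p)%:Z = \sum_(i <- p) F i.
Proof.
move=> p0.
have cntE i : F i * (count_mem i p)%:Z = \sum_(j <- p) (if i == j then F i else 0).
  elim: (p) => [|j q IHq]; first by rewrite big_nil mulr0.
  rewrite big_cons -IHq /= PoszD mulrDr (eq_sym j).
  by case: (i == j); rewrite ?mulr1 ?mulr0.
rewrite (eq_bigr _ (fun i _ => cntE i)) exchange_big /= big_seq [RHS]big_seq.
apply: eq_bigr => j pj; apply: sum_delta; rewrite ltnS leq_sumn // andbT.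
by case: j pj p0 => // ->.
Qed.

Lemma sum_box (p : seq nat) (i : nat) : 0%N \notin p ->
  \sum_(1 <= j < (sumn p).+1) (minn i j)%:Z * (count_mem j p)%:Z = (box p i)%:Z.
Proof.
move=> p0; rewrite (sum_count p (fun j => (minn i j)%:Z)) //.
elim: (p) => [|j q IHq]; first by rewrite box_nil big_nil.
by rewrite big_cons IHq boxE PoszD.
Qed.

(** * Vacancy numbers, cocharge and weight in terms of box counts *)

Section Configurations.
Variables (s : nat) (nu : configuration).
Hypothesis nu_pos : forall a, 0%N \notin nu a.

Lemma vacancyE a i : vacancy s nu a i =
  (if a == node2 then (minn i s)%:Z else 0)
  - \sum_(b : I0) cartan a b * (box (nu b) i)%:Z.
Proof.
rewrite /vacancy; congr (_ - _); apply: eq_bigr => b _.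
rewrite -sum_box // mulr_sumr; apply: eq_bigr => j _.
by rewrite mulrA.
Qed.

Lemma vacancy1E i : vacancy s nu node1 i =
  3 * (box (nu node2) i)%:Z - 2 * (box (nu node1) i)%:Z.
Proof. by rewrite vacancyE sum_nodes /cartan /=; ring. Qed.

Lemma vacancy2E i : vacancy s nu node2 i =
  (minn i s)%:Z + (box (nu node1) i)%:Z - 2 * (box (nu node2) i)%:Z.
Proof. by rewrite vacancyE sum_nodes /cartan /=; ring. Qed.

Lemma sum_root_formE a b :
  \sum_(1 <= i < (sumn (nu a)).+1) \sum_(1 <= j < (sumn (nu b)).+1)
    root_form a b * (minn i j)%:Z * (mult nu a i)%:Z * (mult nu b j)%:Z
  = root_form a b * \sum_(i <- nu a) (box (nu b) i)%:Z.
Proof.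
rewrite -(sum_count _ (fun i => (box (nu b) i)%:Z)) // mulr_sumr.
apply: eq_bigr => i _; rewrite -sum_box // mulr_suml mulr_sumr.
by apply: eq_bigr => j _; rewrite /mult; ring.
Qed.

End Configurations.

Lemma rc_wt1E s x : rc_wt s x 0 node1 =
  3 * (sumn (x.1 node2))%:Z - 2 * (sumn (x.1 node1))%:Z.
Proof.
rewrite /rc_wt sum_nodes /alpha /Lambda /= !mulrnDl !mxE /= !mulmxnE !mxE /=.
by ring.
Qed.

Lemma rc_wt2E s x : rc_wt s x 0 node2 =
  s%:Z + (sumn (x.1 node1))%:Z - 2 * (sumn (x.1 node2))%:Z.
Proof.
rewrite /rc_wt sum_nodes /alpha /Lambda /= !mulrnDl !mxE /= !mulmxnE !mxE /=.
by ring.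
Qed.

(** * Classification of the configurations *)

Lemma vacancy_ge0 s (nu : configuration) :
    (forall a, 0%N \notin nu a) ->
    (forall a i, i \in nu a -> 0 <= vacancy s nu a i) ->
    (2 * sumn (nu node1) <= 3 * sumn (nu node2))%N ->
    (2 * sumn (nu node2) <= s + sumn (nu node1))%N ->
  forall a i, 0 <= vacancy s nu a i.
Proof.
move=> nu0 vac le1 le2 a i.
(* Beyond all parts and beyond s the vacancy numbers are the coordinates of the weight, which [le1]
   and [le2] make nonnegative. *)
set N := (i + s + sumn (nu node1) + sumn (nu node2))%N.
have boxN b : box (nu b) N = sumn (nu b).
  by apply: box_sumn; move: b; apply: node_ind; rewrite /N; lia.
apply: (@ge0_of_concave_at_neg (vacancy s nu a) N); last by rewrite /N; lia.
- by move: a; apply: node_ind; rewrite ?vacancy1E ?vacancy2E // !box0.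
- by move: a; apply: node_ind; rewrite ?vacancy1E ?vacancy2E // !boxN; lia.
move=> j; have [/vac|] := boolP (j.+1 \in nu a); first by left.
(* The box count of [nu a] itself, the only one with a negative coefficient, is linear here; the
   other one and [minn i s] are concave. *)
move=> /box_linear lin; right; move: a lin; apply: node_ind => lin.
  by rewrite !vacancy1E //; have := box_concave (nu node2) j; lia.
by rewrite !vacancy2E //; have := box_concave (nu node1) j; lia.
Qed.

Lemma configuration_classification s (nu : configuration) :
    (1 <= s)%N -> (forall a, is_partition (nu a)) ->
    (forall a i, 0 <= vacancy s nu a i) ->
  exists a b c : nat, [/\ (b <= a)%N, (2 * a <= 3 * b)%N, (b + c <= s)%N,
    nu node1 = [seq j <- [:: a + c; c; c] | (0 < j)%N] &
    nu node2 = [seq j <- [:: b + c; c] | (0 < j)%N]]%N.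
Proof.
move=> s1 part vac.
have nu0 a : 0%N \notin nu a by case/andP: (part a).
have v1 i : 0 <= 3 * (box (nu node2) i)%:Z - 2 * (box (nu node1) i)%:Z.
  by rewrite -(vacancy1E s).
have v2 i : 0 <= (minn i s)%:Z + (box (nu node1) i)%:Z - 2 * (box (nu node2) i)%:Z.
  by rewrite -vacancy2E.
(* The numbers l1, l2 of rows satisfy 2 l1 <= 3 l2 and 2 l2 <= 1 + l1, hence l2 <= 2, and l2
   determines l1. *)
have len1 := v1 1%N; have len2 := v2 1%N; rewrite !box_size // in len1 len2.
case/andP: (part node1) => + p0; case/andP: (part node2) => + q0.
move: (nu node1) (nu node2) len1 len2 v1 v2 p0 q0 => p q.
case: q => [|b1 [|b2 [|b3 q]]] /=; last by lia.
- case: p => [|a1 p] /=; last by lia.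
  by move=> *; exists 0%N, 0%N, 0%N; split.
- case: p => [|a1 [|a2 p]] /=; try lia.
  rewrite !inE => _ _ v1 v2 a1_gt0 b1_gt0 _ _.
  (* The minima of b1 with s and with a1 add up to at least 2 b1, so both equal b1. *)
  have [b1s b1a1] : (b1 <= s)%N /\ (b1 <= a1)%N.
    by have := v2 b1; rewrite !boxE; split; lia.
  have le_a1 : (2 * a1 <= 3 * b1)%N by have := v1 a1; rewrite !boxE; lia.
  exists a1, b1, 0%N; rewrite !addn0 /=.
  have -> : (0 < a1)%N by lia.
  have -> : (0 < b1)%N by lia.
  by split=> //; lia.
case: p => [|a1 [|a2 [|a3 [|a4 p]]]] /=; try lia.
rewrite !inE !negb_or !andbT => _ _ v1 v2 /and3P[a10 a20 a30] /andP[b10 b20].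
move=> b21 /andP[a21 a32].
(* Four minima with b2 add up to at least 4 b2, so none is smaller than b2. The vacancy numbers at
   a3 and then at a2 bound these rows by b2 in the same way. *)
have [b2s b2a3] : (b2 <= s)%N /\ (b2 <= a3)%N.
  by have := v2 b2; rewrite !boxE; split; lia.
have a3E : a3 = b2 by have := v1 a3; rewrite !boxE; lia.
subst a3.
have a2E : a2 = b2 by have := v1 a2; rewrite !boxE; lia.
subst a2.
have [b1s b1a1] : (b1 <= s)%N /\ (b1 <= a1)%N.
  by have := v2 b1; rewrite !boxE; split; lia.
have le_a1 : (2 * a1 + b2 <= 3 * b1)%N by have := v1 a1; rewrite !boxE; lia.
exists (a1 - b2)%N, (b1 - b2)%N, b2; rewrite !subnK //.
have [a1_gt0 b1_gt0 b2_gt0] : [/\ 0 < a1, 0 < b1 & 0 < b2]%N by split; lia.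
by rewrite /= a1_gt0 b1_gt0 b2_gt0; split=> //; lia.
Qed.

(** For the configurations found above, all riggings of rows of one length at one node agree, so
    size and common value identify each multiset. *)
Lemma mset_of_constant (K : choiceType) (A B : multiset K) (v : K) :
    size A = size B -> (forall k, k \in A -> k = v) ->
    (forall k, k \in B -> k = v) -> A = B.
Proof.
move=> szAB Av Bv; rewrite -(seq_mset_id A) -(seq_mset_id B); congr seq_mset.
have cst (M : multiset K) :
    (forall k, k \in M -> k = v) -> M = nseq (size M) v :> seq K.
  by move=> Mv; apply/all_pred1P/allP => k /Mv ->; apply/eqP.
by rewrite (cst A Av) (cst B Bv) szAB.
Qed.

(** * Rigged configurations given by lists of rigged rows *)

(* Rows of length 0 are allowed in L and contribute nothing. *)
Definition rigged_rows (L : I0 -> seq (nat * int)) : rigged_configuration :=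
  (fun a => [seq y.1 | y <- L a & (0 < y.1)%N],
   fun a i => seq_mset [seq y.2 | y <- L a & (0 < y.1)%N && (y.1 == i)]).

Lemma rigged_rows_parts (L : I0 -> seq (nat * int)) a :
  (rigged_rows L).1 a = [seq j <- [seq y.1 | y <- L a] | (0 < j)%N].
Proof. by rewrite filter_map. Qed.

Lemma mem_rigging (L : I0 -> seq (nat * int)) a i k :
  (k \in (rigged_rows L).2 a i) =
  (k \in [seq y.2 | y <- L a & (0 < y.1)%N && (y.1 == i)]).
Proof. by rewrite (perm_mem (perm_eq_seq_mset _)). Qed.

Lemma size_rigging (L : I0 -> seq (nat * int)) a i :
  size ((rigged_rows L).2 a i) = mult (rigged_rows L).1 a i.
Proof.
rewrite (perm_size (perm_eq_seq_mset _)) /mult /= size_map count_map.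
rewrite size_filter count_filter; apply: eq_count => y /=.
by rewrite andbC.
Qed.

Lemma sum_riggings (L : I0 -> seq (nat * int)) a :
  \sum_(1 <= i < (sumn ((rigged_rows L).1 a)).+1)
     \sum_(k <- (rigged_rows L).2 a i) k
  = \sum_(y <- L a | (0 < y.1)%N) y.2.
Proof.
under eq_bigr => i _ do
  rewrite (perm_big _ (perm_eq_seq_mset _)) big_map big_filter.
(* After the exchange, each nonempty row y is counted once, at i = [y.1]. *)
rewrite (exchange_big_dep (fun y => 0 < y.1)%N) /=; last by move=> i y _ /andP[].
rewrite big_seq_cond [RHS]big_seq_cond; apply: eq_bigr => y /andP[Ly y_gt0].
under eq_bigl => i do rewrite y_gt0 eq_sym.
rewrite big_nat1_eq y_gt0 ltnS leq_sumn //.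
by apply: map_f; rewrite mem_filter y_gt0.
Qed.

(** * The bijection and its inverse *)

Definition rows_of (r : quadruple) : I0 -> seq (nat * int) :=
  let: (r1, r2, r3, r4) := r in
  fun a => if a == node1
    then [:: ((r1 + r2 + 2 * r3 + r4)%N, r2%:Z); (r4, 0); (r4, 0)]
    else [:: ((r1 + r2 + r3 + r4)%N, 0); (r4, 0)].

Definition rc_of (r : quadruple) : rigged_configuration := rigged_rows (rows_of r).

(** The default 0 of [head] and [nth] restores the zero parts dropped by [rigged_rows]. The rigging
    of the first row is read off as a sum: if that row is as short as the rows c, all riggings of
    this length are 0 for a highest weight rigged configuration. *)
Definition quadruple_of (x : rigged_configuration) : quadruple :=
  let: (p, q) := (x.1 node1, x.1 node2) in
  let: r2 := `|(\sum_(k <- x.2 node1 (head 0%N p)) k)%R|%N in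
  let: r3 := (head 0%N p - head 0%N q)%N in
  let: r4 := nth 0%N q 1 in
  ((head 0%N q - r4 - r2 - r3)%N, r2, r3, r4).

Section RiggedConfigurationOf.
Variables r1 r2 r3 r4 : nat.
Let r : quadruple := (r1, r2, r3, r4).
Let x := rc_of r.

Lemma rc_of_row1 : x.1 node1 =
  [seq j <- [:: r1 + r2 + 2 * r3 + r4; r4; r4] | (0 < j)%N]%N.
Proof. exact: rigged_rows_parts. Qed.

Lemma rc_of_row2 : x.1 node2 =
  [seq j <- [:: r1 + r2 + r3 + r4; r4] | (0 < j)%N]%N.
Proof. exact: rigged_rows_parts. Qed.

Lemma rc_of_pos a : 0%N \notin x.1 a.
Proof. by move: a; apply: node_ind; rewrite ?rc_of_row1 ?rc_of_row2 mem_filter. Qed.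

Lemma rc_of_partition a : is_partition (x.1 a).
Proof.
rewrite /is_partition rc_of_pos andbT.
have geq_trans : transitive geq by move=> m n p /= mn np; apply: leq_trans np mn.
move: a; apply: node_ind; rewrite ?rc_of_row1 ?rc_of_row2 sorted_filter //=;
  by rewrite !leq_addl ?leqnn.
Qed.

Lemma rc_of_sum1 (F : nat -> int) : F 0%N = 0 ->
  \sum_(i <- x.1 node1) F i = F (r1 + r2 + 2 * r3 + r4)%N + 2 * F r4.
Proof.
by move=> F0; rewrite rc_of_row1 sum_pos // !big_cons big_nil; ring.
Qed.

Lemma rc_of_sum2 (F : nat -> int) : F 0%N = 0 ->
  \sum_(i <- x.1 node2) F i = F (r1 + r2 + r3 + r4)%N + F r4.
Proof.
by move=> F0; rewrite rc_of_row2 sum_pos // !big_cons big_nil addr0.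
Qed.

Lemma rc_of_box1 i : box (x.1 node1) i =
  (minn i (r1 + r2 + 2 * r3 + r4) + 2 * minn i r4)%N.
Proof. by rewrite rc_of_row1 box_pos !boxE; lia. Qed.

Lemma rc_of_box2 i : box (x.1 node2) i =
  (minn i (r1 + r2 + r3 + r4) + minn i r4)%N.
Proof. by rewrite rc_of_row2 box_pos !boxE; lia. Qed.

Lemma rc_of_sumn1 : sumn (x.1 node1) = (r1 + r2 + 2 * r3 + 3 * r4)%N.
Proof. by rewrite rc_of_row1 sumn_pos /=; lia. Qed.

Lemma rc_of_sumn2 : sumn (x.1 node2) = (r1 + r2 + r3 + 2 * r4)%N.
Proof. by rewrite rc_of_row2 sumn_pos /=; lia. Qed.

Lemma rc_of_wt s : rc_wt s x = A_wt s r.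
Proof.
apply/rowP; apply: node_ind.
  by rewrite rc_wt1E rc_of_sumn1 rc_of_sumn2 /= !mxE /=; lia.
by rewrite rc_wt2E rc_of_sumn1 rc_of_sumn2 /= !mxE /=; lia.
Qed.

Lemma rc_of_sum_riggings1 :
  \sum_(y <- rows_of r node1 | (0 < y.1)%N) y.2 = r2%:Z.
Proof.
by rewrite big_mkcond !big_cons big_nil /=; case: posnP => ?; case: posnP; lia.
Qed.

Lemma rc_of_sum_riggings2 :
  \sum_(y <- rows_of r node2 | (0 < y.1)%N) y.2 = 0.
Proof. by rewrite big_mkcond !big_cons big_nil /= !if_same. Qed.

Lemma rc_of_cc : cc x = (gr r)%:R.
Proof.
rewrite /cc (eq_bigr _ (fun a _ => eq_bigr _
  (fun b _ => sum_root_formE x.1 rc_of_pos a b))).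
rewrite !sum_nodes !sum_riggings rc_of_sum_riggings1 rc_of_sum_riggings2.
rewrite !rc_of_sum1 ?box0 // !rc_of_sum2 ?box0 // !rc_of_box1 !rc_of_box2.
rewrite /root_form /tvee /=.
set form := (X in 2^-1 * X%:~R + _).
(* As r4 <= b + c <= a + c, all minima are explicit; b cancels and half the form is a + 3c, the size
   of nu^(1). The rigging r2 then completes [gr]. *)
have -> : form = 2 * (r1 + r2 + 2 * r3 + 3 * r4)%N%:Z by rewrite /form; lia.
rewrite intrM mulrA mulVf // !mul1r -mulrzDr [RHS]pmulrn.
by congr (_ *~ _); lia.
Qed.

Lemma rc_of_RCHW s : Aset s r -> RCHW s x.
Proof.
move=> [le_r31 le_rs]; split.
- exact: rc_of_partition.
- exact: size_rigging.
- move=> a i k; rewrite mem_rigging => /mapP[y].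
  rewrite mem_filter => /andP[/andP[y_gt0 /eqP<-] Ly ->] {k}.
  move: a Ly; apply: node_ind => Ly.
    (* At the first row the vacancy number is 3b - 2a = r1 + r2 - r3, so r2 is admissible exactly
       because r3 <= r1; at the rows r4 it is 0. *)
    rewrite (vacancy1E _ _ rc_of_pos) rc_of_box1 rc_of_box2.
    by move: Ly; rewrite !inE => /or3P[] /eqP-> /=; lia.
  rewrite (vacancy2E _ _ rc_of_pos) rc_of_box1 rc_of_box2.
  by move: Ly; rewrite !inE => /orP[] /eqP-> /=; lia.
rewrite rc_of_wt; apply: node_ind; rewrite !mxE /=; lia.
Qed.

Lemma rc_ofK : quadruple_of x = r.
Proof.
have head1 : head 0%N (x.1 node1) = (r1 + r2 + 2 * r3 + r4)%N.
  by rewrite rc_of_row1 /=; case: posnP => ?; case: posnP => ? /=; lia.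
have head2 : head 0%N (x.1 node2) = (r1 + r2 + r3 + r4)%N.
  by rewrite rc_of_row2 /=; case: posnP => ?; case: posnP => ? /=; lia.
have nth2 : nth 0%N (x.1 node2) 1 = r4.
  by rewrite rc_of_row2 /=; case: posnP => ?; case: posnP => ? /=; lia.
have rig : \sum_(k <- x.2 node1 (r1 + r2 + 2 * r3 + r4)%N) k = r2%:Z.
  rewrite (perm_big _ (perm_eq_seq_mset _)) big_map big_filter.
  rewrite big_mkcond !big_cons big_nil /= eqxx andbT.
  by case: posnP => ? /=; rewrite !if_same; lia.
rewrite /quadruple_of head1 head2 nth2 rig /r.
by congr (_, _, _, _); lia.
Qed.

End RiggedConfigurationOf.

(** * Every highest weight rigged configuration arises from a quadruple *)

Lemma RCHW_rc_of s x : (1 <= s)%N -> RCHW s x -> exists2 r, Aset s r & x = rc_of r.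
Proof.
move=> s1 [part szJ bndJ dom].
have nu0 a : 0%N \notin x.1 a by case/andP: (part a).
have [a [b [c [ba ab bcs nu1 nu2]]]] : exists a b c : nat,
    [/\ (b <= a)%N, (2 * a <= 3 * b)%N, (b + c <= s)%N,
    x.1 node1 = [seq j <- [:: a + c; c; c] | (0 < j)%N] &
    x.1 node2 = [seq j <- [:: b + c; c] | (0 < j)%N]]%N.
  apply: configuration_classification => //; apply: vacancy_ge0 => //.
  (* A part i carries some rigging k, and 0 <= k <= p_i^(a) forces p_i^(a) to be nonnegative. *)
  - move=> a i; rewrite -has_pred1 has_count -[count _ _]/(mult x.1 a i) -szJ.
    case E: (enum_mset (x.2 a i)) => [//|k ks] _.
    have /bndJ/andP[k0 kv] : k \in x.2 a i by rewrite /in_mem /= E mem_head.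
    exact: le_trans kv.
  - by have := dom node1; rewrite rc_wt1E; lia.
  by have := dom node2; rewrite rc_wt2E; lia.
have vac1 i : vacancy s x.1 node1 i =
    3 * (minn i (b + c) + minn i c)%N%:Z - 2 * (minn i (a + c) + 2 * minn i c)%N%:Z.
  by rewrite vacancy1E // nu1 nu2 !box_pos !boxE; lia.
have vac2 i : vacancy s x.1 node2 i =
    (minn i s + minn i (a + c) + 2 * minn i c)%N%:Z
    - 2 * (minn i (b + c) + minn i c)%N%:Z.
  by rewrite vacancy2E // nu1 nu2 !box_pos !boxE; lia.
(* The default 0 serves when a + c = 0 and there is no such row. *)
set k0 : int := head 0 (x.2 node1 (a + c)%N).
have k0_bnd : 0 <= k0 <= 3 * b%:Z - 2 * a%:Z.
  rewrite /k0; case E: (enum_mset _) => [|k ks] /=; first by lia.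
  have /bndJ : k \in x.2 node1 (a + c)%N by rewrite /in_mem /= E mem_head.
  by rewrite vac1; lia.
(* From 3b - 2a = (2b - a) - (a - b), the bound on [k0] says that r3 <= r1; in particular the
   subtractions do not truncate. *)
exists ((2 * b - a - `|k0|)%N, `|k0|%N, (a - b)%N, c); first by split; lia.
set r := (_, _, _, _).
have rows1 : rows_of r node1 = [:: ((a + c)%N, k0); (c, 0); (c, 0)].
  by rewrite /=; congr [:: (_, _); _; _]; lia.
have rows2 : rows_of r node2 = [:: ((b + c)%N, 0); (c, 0)].
  by rewrite /=; congr [:: (_, _); _]; lia.
have nuE : x.1 = (rc_of r).1.
  apply/funext; apply: node_ind.
    by rewrite nu1 [RHS]rigged_rows_parts rows1.
  by rewrite nu2 [RHS]rigged_rows_parts rows2.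
have JE : x.2 = (rc_of r).2.
  apply/funext => d; apply/funext => i.
  (* At every part except a + c in nu^(1) the vacancy number is 0, which forces the rigging 0. *)
  apply: (@mset_of_constant _ _ _
    (if (d == node1) && (i == a + c)%N then k0 else 0)).
  - by rewrite size_rigging szJ nuE.
  - move=> k kJ.
    have i_nu : i \in x.1 d.
      rewrite -has_pred1 has_count -[count _ _]/(mult x.1 d i) -szJ.
      by move: kJ; rewrite /in_mem /=; case: (enum_mset _).
    have k_bnd := bndJ _ _ _ kJ.
    move: k_bnd kJ i_nu; move: d; apply: node_ind => /=.
      rewrite vac1 nu1 mem_filter => k_bnd kJ /andP[i_gt0].
      case: eqVneq => [i_top _|i_ntop]; last first.
        by rewrite !inE (negbTE i_ntop) orbb => /eqP ic; lia.
      (* If a = 0 then b = 0 and the vacancy number is 0 here too; otherwise the row a + c is the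
         only one of its length. *)
      have [a_eq0|a_gt0] := posnP a; first by lia.
      have : size (x.2 node1 i) = 1%N.
        rewrite szJ /mult nu1 i_top /= addn_gt0 a_gt0 /= eqxx.
        case: posnP => //= _; have /negbTE-> : c != (a + c)%N by lia.
        by [].
      move: kJ; rewrite /k0 -i_top /in_mem /=.
      by case: (enum_mset _) => [|k1 [|]] /=; rewrite ?inE => // /eqP.
    rewrite vac2 nu2 mem_filter => k_bnd _ /andP[i_gt0].
    by rewrite !inE => /orP[]/eqP ?; lia.
  move=> k; rewrite mem_rigging => /mapP[y].
  rewrite mem_filter => /andP[/andP[y_gt0 /eqP<-] + ->] {k}.
  move: d; apply: node_ind; rewrite ?rows1 ?rows2 !inE.
    by case/or3P=> /eqP-> /=; case: eqP => //; lia.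
  by case/orP=> /eqP->.
by rewrite [x]surjective_pairing [RHS]surjective_pairing nuE JE.
Qed.

Theorem proposition4p9 (s : nat) (hs : (1 <= s)%N) :
  exists Psi : rigged_configuration -> quadruple,
    set_bij (RCHW s) (Aset s) Psi /\
    (forall x : rigged_configuration, RCHW s x ->
       cc x = (gr (Psi x))%:R /\ rc_wt s x = A_wt s (Psi x)).
Proof.
(* With [RCHW_rc_of], this reduces injectivity and both statistics to the explicit [rc_of r]. *)
have rcK r : quadruple_of (rc_of r) = r by case: r => [[[]]]; apply: rc_ofK.
exists quadruple_of; split.
  split.
  - by move=> x /(RCHW_rc_of _ _ hs)[r Ar ->]; rewrite rcK.
  - move=> x y; rewrite !inE => /(RCHW_rc_of _ _ hs)[r _ ->].
    by move=> /(RCHW_rc_of _ _ hs)[r' _ ->]; rewrite !rcK => ->.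
  move=> [[[r1 r2] r3] r4] Ar.
  by exists (rc_of (r1, r2, r3, r4)); [apply: rc_of_RCHW | apply: rcK].
move=> x /(RCHW_rc_of _ _ hs)[[[[r1 r2] r3] r4] _ ->].
by rewrite rcK rc_of_cc rc_of_wt.
Qed.
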